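(* Let $\mathbf{A}$ be a finite idempotent algebra and $B$ a subuniverse of $\mathbf{A}$. Then the following are equivalent: (i) $B$ absorbs $\mathbf{A}$; (ii) $B$ Jónsson absorbs $\mathbf{A}$ and $\mathbf{A}$ has no $B$-blocker.
   Context: An algebra is idempotent if every basic operation $f$ satisfies $f(x,\dots,x)\approx x$. Absorption: a subuniverse $B$ of $\mathbf{A}$ absorbs $\mathbf{A}$ if there is an idempotent term $t$ of $\mathbf{A}$, say $n$-ary, such that $t(a_1,\dots,a_n)\in B$ whenever all but at most one of the $a_i$ lie in $B$ and the remaining one lies in $A$. Jónsson absorption: a subuniverse $B$ of $\mathbf{A}$ Jónsson absorbs $\mathbf{A}$ if there are ternary terms $d_0,\dots,d_n$ of $\mathbf{A}$ such that $d_i(b,a,b')\in B$ for all $i$, all $b,b'\in B$, $a\in A$; $d_i(x,y,y)=d_{i+1}(x,x,y)$ for all $i<n$ and all $x,y\in A$; $d_0(x,y,z)=x$ and $d_n(x,y,z)=z$ for all $x,y,z\in A$. $B$-blocker: for a subuniverse $B$ of $\mathbf{A}$, a pair $(C,D)$ of subsets of $A$ is a $B$-blocker of $\mathbf{A}$ if (1) $D$ is a subuniverse of $\mathbf{A}$; (2) $\emptyset\neq C\subseteq D$; (3) $C\cap B=\emptyset$; (4) $D\cap B\neq\emptyset$; (5) for every $n\ge 1$, the set $D^n\setminus (D\setminus C)^n$ is a subuniverse of $\mathbf{A}^n$. *)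

(* Defs.v *)
From mathcomp Require Import all_boot.
Set Implicit Arguments.
Unset Strict Implicit.
Unset Printing Implicit Defensive.

Definition idempotent_alg (A : finType) (I : Type) (ar : I -> nat)
  (op : forall i, ('I_(ar i) -> A) -> A) : Prop :=
  forall i (a : A), op i (fun _ => a) = a.

Definition subuniverse (A : finType) (I : Type) (ar : I -> nat)
  (op : forall i, ('I_(ar i) -> A) -> A) (B : {set A}) : Prop :=
  forall i (x : 'I_(ar i) -> A), (forall j, x j \in B) -> op i x \in B.

Definition subuniverse_pow (A : finType) (I : Type) (ar : I -> nat)
  (op : forall i, ('I_(ar i) -> A) -> A) (n : nat)
  (S : ('I_n -> A) -> Prop) : Prop :=
  forall i (x : 'I_(ar i) -> 'I_n -> A),
    (forall j, S (x j)) -> S (fun k => op i (fun j => x j k)).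

Inductive term (I : Type) (ar : I -> nat) (n : nat) : Type :=
| Var of 'I_n
| App (i : I) of ('I_(ar i) -> term ar n).

Fixpoint eval (A : Type) (I : Type) (ar : I -> nat)
  (op : forall i, ('I_(ar i) -> A) -> A) (n : nat)
  (t : term ar n) (x : 'I_n -> A) {struct t} : A :=
  match t with
  | Var j => x j
  | App i ts => op i (fun j => eval op (ts j) x)
  end.

Definition tri (A : Type) (x y z : A) : 'I_3 -> A :=
  fun k => match val k with 0 => x | 1 => y | _ => z end.

Definition absorbs (A : finType) (I : Type) (ar : I -> nat)
  (op : forall i, ('I_(ar i) -> A) -> A) (B : {set A}) : Prop :=
  exists (n : nat) (t : term ar n),
    (forall a : A, eval op t (fun _ => a) = a) /\
    (forall x : 'I_n -> A,
       #|[set k | x k \notin B]| <= 1 -> eval op t x \in B).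

Definition jonsson_absorbs (A : finType) (I : Type) (ar : I -> nat)
  (op : forall i, ('I_(ar i) -> A) -> A) (B : {set A}) : Prop :=
  exists (m : nat) (d : nat -> term ar 3),
    (forall i, i <= m -> forall b a b', b \in B -> b' \in B ->
        eval op (d i) (tri b a b') \in B) /\
    (forall i, i < m -> forall x y : A,
        eval op (d i) (tri x y y) = eval op (d i.+1) (tri x x y)) /\
    (forall x y z : A, eval op (d 0) (tri x y z) = x) /\
    (forall x y z : A, eval op (d m) (tri x y z) = z).

Definition blocker (A : finType) (I : Type) (ar : I -> nat)
  (op : forall i, ('I_(ar i) -> A) -> A) (B C D : {set A}) : Prop :=
  [/\ subuniverse op D,
      C != set0 /\ C \subset D,
      [disjoint C & B],
      ~~ [disjoint D & B] &
      forall n : nat, 0 < n ->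
        subuniverse_pow op
          (fun x : 'I_n -> A =>
             (forall k, x k \in D) /\ ~ (forall k, x k \in D :\: C))].

(* Main.v *)
(* Relations are graded: [R : seq A -> Prop] holds an [n]-ary relation for every
   [n], and it is B-free when it contains no tuple over B. The hard direction
   takes Jonsson terms [d_0, ..., d_m] and the failure of absorption, and
   produces a blocker.

   If B does not absorb A, there are B-free compatible relations of every arity
   [N] containing, for each [k], a tuple lying in B off coordinate [k]. By
   Ramsey's theorem these tuples may be assumed to be [b'^k a be^l] with fixed
   [a], [b'], [be].

   Applying [d_i] to such tuples turns [b'] into [phi_i b' = d_i(be, be, b')]
   and [a] into [phi_i a], at the price of an additional nonmember [d_i(a, b',
   b')] of B somewhere on the left. If no relation generated by all [w^k c w^l]
   were B-free, the additional entry could be moved into B; enlarging the set L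
   of letters allowed on the left as long as possible, L becomes closed under
   [phi_m, ..., phi_0], and so contains [phi_0 b' = be], a contradiction. Hence
   some relation generated by the permutations of [c w^l] is B-free.

   Now enlarge [{w}] to a maximal set D such that some [c] is elusive, i.e. the
   permutations of [c y], [y] a tuple over D, generate a B-free relation. Along
   [d_0(c, c, w) = c, d_0(c, w, w) = d_1(c, c, w), ..., d_m(c, w, w) = w]
   elusiveness is lost at some [i]; then [d_i(c, c, w)] may be adjoined to D, so
   it is an elusive element of D. Finally, for C maximal such that the tuples
   over D with an entry in C generate a B-free relation, (C, D) is a blocker. *)

Require Import Defs.
From mathcomp Require Import all_boot.
From mathcomp Require Import boolp zify.
Set Implicit Arguments.
Unset Strict Implicit.
Unset Printing Implicit Defensive.

(** * Finite preorders and Ramsey's theorem *)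

(** Up-sets shrink along [r], so an element above [x] with the smallest up-set is terminal. *)
Lemma finite_terminal (T : finType) (r : T -> T -> Prop) (x : T) :
  (forall y, r y y) -> (forall y z t, r y z -> r z t -> r y t) ->
  exists2 y, r x y & forall z, r y z -> r z y.
Proof.
move=> rxx rtr.
pose up y := [set z | `[<r y z>]].
case: (@arg_minnP _ x (fun y => `[<r x y>]) (fun y => #|up y|)); first exact/asboolP.
move=> y /asboolP rxy ymin; exists y => // z ryz.
have szy : up z \subset up y.
  by apply/subsetP => t; rewrite !inE => /asboolP rzt; apply/asboolP/(rtr _ _ _ ryz).
have /asboolP rxz := rtr _ _ _ rxy ryz.
have : y \in up y by rewrite inE; apply/asboolP.
have /eqP <- : up z == up y by rewrite eqEcard szy ymin.
by rewrite inE => /asboolP.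
Qed.

Lemma pigeonhole_count (T : Type) (K : finType) (k0 : K) (f : T -> K) (n : nat) (s : seq T) :
  n * #|K| <= size s -> exists k, n <= count (fun x => f x == k) s.
Proof.
move=> les; have sum_count : \sum_k count (fun x => f x == k) s = size s.
  elim: s {les} => [|x s IHs] /=; first by rewrite big1.
  rewrite big_split /= IHs (bigD1 (f x)) //= eqxx big1 // => k.
  by rewrite eq_sym => /negPf->.
apply: contrapT => /forallNP small.
have ltc k : count (fun x => f x == k) s < n by rewrite ltnNge; apply/negP/small.
suff : size s < n * #|K| by rewrite ltnNge les.
rewrite -sum_count mulnC -sum_nat_const.
have cardK : 0 < #|K| by apply/card_gt0P; exists k0.
rewrite (bigD1 k0) //= [in leqRHS](bigD1 k0) //= -addSn leq_add //.
by apply: leq_sum => k _; apply: ltnW.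
Qed.

(** First a subsequence is extracted on which the color of a pair depends on its earlier element
    only; pigeonhole on these colors then makes it constant. *)
Lemma pairwise_ramsey (K : finType) (k0 : K) (n : nat) :
  exists N, forall (T : eqType) (s : seq T) (c : T -> T -> K), uniq s -> N <= size s ->
    exists t k, [/\ subseq t s, size t = n & pairwise (fun i j => c i j == k) t].
Proof.
have [N HN] : exists N, forall (T : eqType) (s : seq T) (c : T -> T -> K), uniq s -> N <= size s ->
    exists t col, [/\ subseq t s, size t = n * #|K|
                    & pairwise (fun i j => c i j == col i) t].
  elim: (n * #|K|) => [|p [N HN]].
    by exists 0 => T s c _ _; exists [::], (fun x => c x x); rewrite sub0seq.
  exists (N * #|K|).+1 => T [|x s] c //= /andP[xs us]; rewrite ltnS => les.
  have [k lek] := pigeonhole_count k0 (c x) les.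
  have [||t [col [sub_t szt pw]]] := HN T [seq y <- s | c x y == k] c; first exact: filter_uniq.
    by rewrite size_filter.
  have sub_s : subseq t s := subseq_trans sub_t (filter_subseq _ _).
  exists (x :: t), (fun y => if y == x then k else col y); split=> /=.
  - by rewrite eqxx.
  - by rewrite szt.
  apply/andP; split.
    apply/allP => y yt; rewrite eqxx.
    by have := mem_subseq sub_t yt; rewrite mem_filter => /andP[].
  apply: (@sub_in_pairwise _ (mem t) _ _ _ t _ pw) => [y z yt _ /=|]; last exact/allP.
  by rewrite ifN //; apply: contraNneq xs => <-; apply: (mem_subseq sub_s yt).
exists N => T s c us les; have [t [col [sub_t szt pw]]] := HN T s c us les.
have [k lek] : exists k, n <= count (fun x => col x == k) t.
  by apply: pigeonhole_count k0 _ _ _ _; rewrite szt.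
exists (take n [seq x <- t | col x == k]), k; split.
- exact: subseq_trans (take_subseq _ _) (subseq_trans (filter_subseq _ _) sub_t).
- by rewrite size_takel // size_filter.
apply: (subseq_pairwise (take_subseq _ _)).
have : pairwise (fun i j => c i j == col i) [seq x <- t | col x == k].
  exact: subseq_pairwise (filter_subseq _ _) pw.
apply: (@sub_in_pairwise _ (fun y => col y == k)); last exact: filter_all.
by move=> y z /eqP->.
Qed.

(** * Generated relations *)

Section Relations.

Variables (A : finType) (I : Type) (ar : I -> nat).
Variable op : forall i, ('I_(ar i) -> A) -> A.
Arguments op {i}.
Hypothesis op_idem : idempotent_alg (@op).
Variable B : {set A}.
Hypothesis subB : subuniverse (@op) B.
Variable b0 : A.
Hypothesis b0B : b0 \in B.

(* A graded relation: the tuples of length [n] in [R] form an [n]-ary relation.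
   The arguments of an operation are given as a list of columns. *)
Definition closed (R : seq A -> Prop) : Prop :=
  forall i (cols : seq ('I_(ar i) -> A)),
    (forall j, R [seq c j | c <- cols]) -> R [seq op c | c <- cols].

Inductive Sg (G : seq A -> Prop) : seq A -> Prop :=
| Sg_gen x : G x -> Sg G x
| Sg_op i (cols : seq ('I_(ar i) -> A)) :
    (forall j, Sg G [seq c j | c <- cols]) -> Sg G [seq op c | c <- cols].

Definition Bfree (R : seq A -> Prop) : Prop := forall x, all [in B] x -> ~ R x.

Lemma Sg_closed G : closed (Sg G).
Proof. exact: Sg_op. Qed.

Lemma Sg_min (G R : seq A -> Prop) :
  closed R -> (forall x, G x -> R x) -> forall x, Sg G x -> R x.
Proof. by move=> Rcl GR x; elim=> [y /GR //|i cols _ IH]; apply: Rcl. Qed.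

Lemma Sg_sub (G G' : seq A -> Prop) :
  (forall x, G x -> Sg G' x) -> forall x, Sg G x -> Sg G' x.
Proof. by move=> sub; apply: Sg_min => //; apply: Sg_closed. Qed.

(** Operations preserve length, so generators of other lengths do not contribute. This bounds the
    copies of a letter in [elusive_setU1] and the rounds in [reach_setU]. *)
Lemma Sg_size (G : seq A -> Prop) x :
  Sg G x -> Sg (fun z => G z /\ size z = size x) x.
Proof.
elim=> [y Gy|i cols _ IH]; first exact: Sg_gen.
by apply: Sg_op => j; move: (IH j); rewrite !size_map.
Qed.

Lemma Sg_perm (G : seq A -> Prop) :
  (forall x y, perm_eq x y -> G x -> G y) ->
  forall x y, perm_eq x y -> Sg G x -> Sg G y.
Proof.
move=> Gperm x y pxy Sx; elim: Sx y pxy => {x} [x Gx|i cols _ IH] y.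
  by move=> pxy; apply/Sg_gen/(Gperm x).
rewrite perm_sym => /(perm_iotaP b0)[Is pIs ->].
have ltIs k : k \in Is -> k < size cols.
  by rewrite (perm_mem pIs) mem_iota add0n size_map.
pose c0 : 'I_(ar i) -> A := fun=> b0.
have -> : [seq nth b0 [seq op c | c <- cols] k | k <- Is] =
          [seq op c | c <- [seq nth c0 cols k | k <- Is]].
  by rewrite -map_comp; apply/eq_in_map => k /ltIs ltk /=; rewrite (nth_map c0).
apply: Sg_op => j; apply: IH; rewrite perm_sym; apply/(perm_iotaP b0).
exists Is; first by rewrite size_map -(size_map op).
by rewrite -map_comp; apply/eq_in_map => k /ltIs ltk /=; rewrite (nth_map c0).
Qed.

Lemma Bfree_sub (R R' : seq A -> Prop) :
  (forall x, R x -> R' x) -> Bfree R' -> Bfree R.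
Proof. by move=> sub free x Bx /sub; apply: free. Qed.

Lemma not_Bfree (R : seq A -> Prop) : ~ Bfree R -> exists2 x, all [in B] x & R x.
Proof. by move=> /existsNP[x /not_implyP[Bx /contrapT Rx]]; exists x. Qed.

Lemma all_op (D : {set A}) i (cols : seq ('I_(ar i) -> A)) : subuniverse (@op) D ->
  (forall j, all [in D] [seq c j | c <- cols]) -> all [in D] [seq op c | c <- cols].
Proof.
move=> subD; elim: cols => //= c cols IH Dc.
rewrite IH ?andbT; last by move=> j; case/andP: (Dc j).
by apply: subD => j; case/andP: (Dc j).
Qed.

(** By idempotence constant columns are kept, so the fixed entries [u] and [v] survive every
    operation. *)
Lemma closed_fiber R (u v : seq A) : closed R -> closed (fun z => R (u ++ z ++ v)).
Proof.
move=> Rcl i cols Rcols.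
pose const (w : seq A) := [seq (fun _ : 'I_(ar i) => a) | a <- w].
have opconst w : [seq op c | c <- const w] = w.
  by rewrite -map_comp -[RHS]map_id; apply: eq_map => a /=; apply: op_idem.
have := Rcl i (const u ++ cols ++ const v); rewrite !map_cat !opconst; apply=> j.
by rewrite !map_cat -![map _ (const _)]map_comp !map_id.
Qed.

(** Prefixes stay over [B] because [B] is a subuniverse; their common length [q] lets them be
    transposed into columns. *)
Lemma closed_junk R q : closed R ->
  closed (fun z => exists g, [/\ size g = q, all [in B] g & R (g ++ z)]).
Proof.
move=> Rcl i cols /fin_all_exists[g Hg].
pose gcols := mkseq (fun k (j : 'I_(ar i)) => nth b0 (g j) k) q.
have gE j : [seq c j | c <- gcols] = g j.
  by case: (Hg j) => sz _ _; rewrite -map_comp -[RHS](mkseq_nth b0) sz.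
exists [seq op c | c <- gcols]; split.
- by rewrite size_map size_mkseq.
- by apply: (all_op subB) => j; rewrite gE; case: (Hg j).
by rewrite -map_cat; apply: Rcl => j; rewrite map_cat gE; case: (Hg j).
Qed.

(* Puts the block [g_k] in front of the letter [z_k]. *)
Definition weave T (g : seq (seq T)) (z : seq T) : seq T :=
  flatten [seq rcons p.1 p.2 | p <- zip g z].

Lemma map_weave T U (f : T -> U) g z :
  map f (weave g z) = weave (map (map f) g) (map f z).
Proof.
by elim: g z => [|u g IH] [|c z] //=; move: (IH z); rewrite /weave /= map_cat map_rcons => ->.
Qed.

Lemma weave_cat T (g1 g2 : seq (seq T)) z1 z2 : size g1 = size z1 ->
  weave (g1 ++ g2) (z1 ++ z2) = weave g1 z1 ++ weave g2 z2.
Proof. by move=> sz; rewrite /weave zip_cat // map_cat flatten_cat. Qed.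

Lemma all_weave T (P : pred T) g z :
  all (all P) g -> all P z -> all P (weave g z).
Proof.
elim: g z => [|u g IH] [|c z] //= /andP[Pu Pg] /andP[Pc Pz].
by rewrite all_cat all_rcons Pc Pu /= IH.
Qed.

Lemma closed_weave R q : closed R ->
  closed (fun z => exists g, [/\ size g = size z, all (fun u => size u == q) g,
                                 all (all [in B]) g & R (weave g z)]).
Proof.
move=> Rcl i cols; rewrite size_map => /fin_all_exists[g Hg].
pose G := mkseq (fun k => mkseq (fun p (j : 'I_(ar i)) => nth b0 (nth [::] (g j) k) p) q)
                (size cols).
have gE j : [seq [seq c j | c <- u] | u <- G] = g j.
  case: (Hg j) => sz /(all_nthP [::]) szq _ _.
  rewrite size_map in sz; rewrite -map_comp -[RHS](mkseq_nth [::]) sz.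
  apply/eq_in_map => k; rewrite mem_iota /= => ltk.
  rewrite -map_comp -[RHS](mkseq_nth b0) /=; congr mkseq.
  by rewrite (eqP (szq k _)) // sz.
exists [seq [seq op c | c <- u] | u <- G]; split.
- by rewrite !size_map size_iota.
- by apply/allP => u /mapP[v /mapP[k _ ->] ->]; rewrite size_map size_mkseq.
- apply/allP => u /mapP[v vG ->]; apply: (all_op subB) => j.
  case: (Hg j) => _ _ /allP Bg _; apply: Bg; rewrite -gE.
  exact: (map_f (map (fun c => c j))).
rewrite -map_weave; apply: Rcl => j; rewrite map_weave gE.
by case: (Hg j).
Qed.

Lemma eval_idem n (t : term ar n) (x : 'I_n -> A) a :
  (forall k, x k = a) -> eval (@op) t x = a.
Proof.
move=> xa; elim: t => [k|i ts IH] //=.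
rewrite -[RHS](op_idem i a); congr op; exact/funext.
Qed.

Lemma closed_eval R n (t : term ar n) (cols : seq ('I_n -> A)) : closed R ->
  (forall j, R [seq c j | c <- cols]) -> R [seq eval (@op) t c | c <- cols].
Proof.
move=> Rcl Rcols; elim: t => [k|i ts IH] //=.
pose C := [seq (fun j => eval (@op) (ts j) c) | c <- cols].
have -> : [seq op (fun j => eval (@op) (ts j) c) | c <- cols] = [seq op c | c <- C].
  by rewrite -map_comp.
by apply: Rcl => j; rewrite -map_comp; apply: IH.
Qed.

Definition eval3 (t : term ar 3) (x y z : A) : A := eval (@op) t (tri x y z).

Lemma eval3_idem t x : eval3 t x x x = x.
Proof. by apply: eval_idem; case=> [[|[|[|?]]] ?]. Qed.

(** The list [s] of entry triples displays the three argument tuples coordinate by coordinate. *)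
Lemma closed_eval3 R (t : term ar 3) (s : seq (A * A * A)) : closed R ->
  R [seq p.1.1 | p <- s] -> R [seq p.1.2 | p <- s] -> R [seq p.2 | p <- s] ->
  R [seq eval3 t p.1.1 p.1.2 p.2 | p <- s].
Proof.
move=> Rcl R1 R2 R3.
have := @closed_eval R 3 t [seq tri p.1.1 p.1.2 p.2 | p <- s] Rcl.
rewrite -map_comp; apply=> -[[|[|[|//]]] ltj]; rewrite -map_comp //.
Qed.

(* Each letter listed in [s] may be used once; a letter can be adjoined to D when
   arbitrarily many copies of it may be listed, see [elusive_setU1]. *)
Definition elusive_gen (D : {set A}) (c : A) (s z : seq A) : Prop :=
  exists u y, [/\ subseq u s, all [in D] y & perm_eq z (c :: u ++ y)].

Definition elusive D c s : Prop := Bfree (Sg (elusive_gen D c s)).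

Lemma elusive_gen_perm D c s x y : perm_eq x y -> elusive_gen D c s x -> elusive_gen D c s y.
Proof.
move=> pxy [u [v [us Dv px]]]; exists u, v; split=> //.
by rewrite -(permPl pxy).
Qed.

Lemma elusive_gen_set1 w c z : elusive_gen [set w] c [::] z ->
  exists z1 z2, [/\ z = z1 ++ c :: z2, all (pred1 w) z1 & all (pred1 w) z2].
Proof.
case=> u [s [+ ws pz]]; rewrite subseq0 => /eqP u0; rewrite u0 cat0s in pz.
have cz : c \in z by rewrite (perm_mem pz) mem_head.
case/splitPr: cz pz => z1 z2; rewrite -cat1s perm_catCA perm_cons => pz.
have : all (pred1 w) (z1 ++ z2).
  by rewrite (perm_all _ pz); apply: sub_all ws => k /set1P->; apply: eqxx.
by rewrite all_cat => /andP[w1 w2]; exists z1, z2.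
Qed.

Lemma elusive_subseq D c s s' : subseq s' s -> elusive D c s -> elusive D c s'.
Proof.
move=> ss; apply: Bfree_sub; apply: Sg_sub => z [u [y [us Dy pz]]]; apply: Sg_gen.
by exists u, y; split=> //; apply: subseq_trans ss.
Qed.

(* In a tuple of the new relation either the entry [d(c, c, w)] is used as the
   new letter, or it is replaced by [d(c, w, w)], which is moved into B and
   projected away. *)
Lemma elusive_step (D : {set A}) (w : A) (t : term ar 3) (c : A) (s : seq A) :
  w \in D -> w \in B -> eval3 t w c w \in B ->
  ~ elusive D (eval3 t c w w) [::] -> elusive D c s ->
  elusive D (eval3 t w w c) (eval3 t c c w :: s).
Proof.
move=> wD wB; set e := eval3 t w c w => eB /not_Bfree[z0 Bz0 Sz0] el.
set f := eval3 t w w c; set v := eval3 t c c w.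
set R := Sg (elusive_gen D c s); have Rcl : closed R by apply: Sg_closed.
have Rperm x y : perm_eq x y -> R x -> R y by apply/Sg_perm/elusive_gen_perm.
have RI u y z : subseq u s -> all [in D] y -> perm_eq z (c :: u ++ y) -> R z.
  by move=> us Dy pz; apply: Sg_gen; exists u, y.
pose tripled (r : seq A) := [seq (a, a, a) | a <- r].
have evalt r : [seq eval3 t p.1.1 p.1.2 p.2 | p <- tripled r] = r.
  by rewrite -map_comp -[RHS]map_id; apply: eq_map => a /=; rewrite eval3_idem.
have t11 r : [seq p.1.1 | p <- tripled r] = r by rewrite -map_comp map_id.
have t12 r : [seq p.1.2 | p <- tripled r] = r by rewrite -map_comp map_id.
have t2 r : [seq p.2 | p <- tripled r] = r by rewrite -map_comp map_id.
have R_junk u y : subseq u s -> all [in D] y -> R (z0 ++ e :: f :: u ++ y).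
  move=> us Dy.
  refine (Sg_min (@closed_fiber R [::] (e :: f :: u ++ y) Rcl) _ Sz0) => z [u0 [y0 [+ Dy0 pz]]].
  rewrite subseq0 => /eqP u00; rewrite u00 /= in pz.
  pose r := u ++ (y0 ++ y).
  have Dr : all [in D] (w :: w :: y0 ++ y) by rewrite /= wD all_cat Dy0.
  (* Three generators carry [c] at three different places and [w] at the other two; there [t] yields
     [eval3 t c w w], [e] and [f]. *)
  have := @closed_eval3 R t ((c, w, w) :: (w, c, w) :: (w, w, c) :: tripled r) Rcl.
  rewrite /= t11 t12 t2 evalt => Rr.
  apply: Rperm; last first.
    apply: Rr; apply: (RI _ _ _ us Dr); rewrite /r; apply/permP => P;
      rewrite /= !count_cat /= count_cat; lia.
  apply/permP => P; move/permP/(_ P): pz => /=; rewrite !count_cat /= !count_cat => ->.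
  rewrite -/e -/f; lia.
have R_option u y : subseq u s -> all [in D] y -> R (v :: f :: u ++ y).
  move=> us Dy; pose r := u ++ y.
  (* Now the first two arguments carry [c] at the same place, which yields [v]. *)
  have := @closed_eval3 R t ((c, c, w) :: (w, w, c) :: tripled r) Rcl.
  rewrite /= t11 t12 t2 evalt; apply;
    apply: (RI _ (w :: y) _ us); rewrite /= ?wD //; rewrite /r; apply/permP => P;
    rewrite /= !count_cat /=; lia.
have R'cl := @closed_junk R (size z0).+1 Rcl.
move=> x Bx /(Sg_min R'cl)[z [u [y [us Dy pz]]]|g [_ Bg]]; last first.
  by apply: el; rewrite all_cat Bg.
case: u us pz => [|a u]; last case: (a =P v) => [->|av].
- move=> _ pz; exists (rcons z0 e); rewrite size_rcons all_rcons eB; split=> //.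
  apply: (Rperm (z0 ++ e :: f :: y)); last exact: (R_junk [::]) (sub0seq _) Dy.
  apply/permP => P; move/permP/(_ P): pz => /=; rewrite cat_rcons !count_cat /= => ->; lia.
(* The letter [v] is used. Copies of [w], which lies in both [B] and [D], pad the prefix to the
   length needed in the other cases. *)
- rewrite /= eqxx => us pz; exists (nseq (size z0).+1 w); split.
  + by rewrite size_nseq.
  + by rewrite all_nseq wB orbT.
  apply: (Rperm (v :: f :: u ++ (nseq (size z0).+1 w ++ y))).
    by apply/permP => P; move/permP/(_ P): pz; rewrite /= !count_cat /= !count_cat => ->; lia.
  by apply: R_option => //; rewrite all_cat all_nseq Dy wD orbT.
move=> us pz; have {}us : subseq (a :: u) s by move: us => /=; case: eqP.
exists (rcons z0 e); rewrite size_rcons all_rcons eB; split=> //.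
apply: (Rperm (z0 ++ e :: f :: (a :: u) ++ y)); last exact: R_junk.
apply/permP => P; move/permP/(_ P): pz => /=; rewrite cat_rcons !count_cat /= => ->.
by rewrite count_cat; lia.
Qed.

(** * Elusive elements and blockers *)

Variables (m : nat) (d : nat -> term ar 3).
Hypothesis dB : forall i, i <= m ->
  forall b a b', b \in B -> b' \in B -> eval3 (d i) b a b' \in B.
Hypothesis d_link : forall i, i < m ->
  forall x y, eval3 (d i) x y y = eval3 (d i.+1) x x y.
Hypothesis d_first : forall x y z, eval3 (d 0) x y z = x.
Hypothesis d_last : forall x y z, eval3 (d m) x y z = z.

Lemma elusive_notB D c s : elusive D c s -> c \notin B.
Proof.
move=> el; apply/negP => cB; apply: (el [:: c]); first by rewrite /= cB.
by apply: Sg_gen; exists [::], [::]; rewrite sub0seq.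
Qed.

(** By [d_link] the elements form a chain from [c] to [w]. As [w] lies in [B], it is not elusive, so
    elusiveness is lost inside some [d i]. *)
Lemma elusive_crossing D c w : w \in B -> elusive D c [::] -> exists i,
  [/\ i <= m, elusive D (eval3 (d i) c c w) [::]
    & ~ elusive D (eval3 (d i) c w w) [::]].
Proof.
move=> wB el; apply: contrapT => /forallNP nocross.
have step i : i <= m -> elusive D (eval3 (d i) c c w) [::] ->
    elusive D (eval3 (d i) c w w) [::].
  by move=> le_im el_i; apply: contrapT => nel; apply: (nocross i).
have el_all i : i <= m -> elusive D (eval3 (d i) c c w) [::].
  elim: i => [|i IH] le_im; first by rewrite d_first.
  by rewrite -d_link //; apply: step; [apply: ltnW | apply/IH/ltnW].
by have := elusive_notB (step m (leqnn _) (el_all m (leqnn _))); rewrite d_last wB.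
Qed.

(** A tuple uses at most as many copies of [x] as its length, so that many listed copies replace [x]
    as a letter of the alphabet. *)
Lemma elusive_setU1 (D : {set A}) c x :
  (forall n, elusive D c (nseq n x)) -> elusive (x |: D) c [::].
Proof.
move=> el z Bz /Sg_size Sz; apply: (el (size z) z Bz).
apply: Sg_sub Sz => y [[u [v [+ Dv py]]] szy]; rewrite subseq0 => /eqP u0.
rewrite u0 /= in py; apply: Sg_gen.
exists (filter (pred1 x) v), (filter (predC (pred1 x)) v); split.
- have /all_pred1P -> : all (pred1 x) (filter (pred1 x) v) by apply: filter_all.
  have le : size (filter (pred1 x) v) <= size z.
    rewrite -szy (perm_size py) size_filter /=; apply: leqW; apply: count_size.
  by rewrite -(subnKC le) nseqD prefix_subseq.
- apply/allP => a; rewrite mem_filter => /andP[/= nax /(allP Dv)].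
  by rewrite !inE (negbTE nax).
by rewrite (permPl py) perm_cons perm_sym perm_filterC.
Qed.

(** The letters [op y] are traded one at a time for the [y j], the other entries being fixed. Hence
    a maximal [D] is a subuniverse. *)
Lemma elusive_op (D : {set A}) c i (y : 'I_(ar i) -> A) :
  (forall j, y j \in D) -> elusive D c [::] -> elusive (op y |: D) c [::].
Proof.
move=> Dy; set o := op y; apply: Bfree_sub; apply: Sg_sub.
set R := Sg (elusive_gen D c [::]).
have Rperm x z : perm_eq x z -> R x -> R z by apply/Sg_perm/elusive_gen_perm.
suff RI y1 y2 : all [in o |: D] y1 -> all [in D] y2 -> R (c :: y1 ++ y2).
  move=> z [u [v [+ Dv pz]]]; rewrite subseq0 => /eqP u0; rewrite u0 in pz.
  by apply: (Rperm (c :: v)); rewrite 1?perm_sym // -[v]cats0; apply: RI.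
elim: y1 y2 => [|a y1 IH] y2 /=.
  by move=> _ Dy2; apply: Sg_gen; exists [::], y2; rewrite sub0seq.
move=> /andP[+ Dy1] Dy2; rewrite in_setU1 => /orP[/eqP-> | aD]; last first.
  apply: (Rperm (c :: y1 ++ a :: y2)); last by apply: IH; rewrite //= aD.
  by rewrite perm_cons (perm_catCA y1 [:: a]).
have /(_ i [:: y]) := @closed_fiber R (c :: y1) y2 (@Sg_closed _); rewrite /= => Ro.
apply: (Rperm (c :: y1 ++ o :: y2)).
  by rewrite perm_cons (perm_catCA y1 [:: o]).
by apply: Ro => j; apply: IH; rewrite //= Dy.
Qed.

Lemma elusive_self w a : w \in B -> elusive [set w] a [::] ->
  exists D x, [/\ subuniverse (@op) D, w \in D, x \in D & elusive D x [::]].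
Proof.
move=> wB ela.
pose P (D : {set A}) := (w \in D) && `[<exists c, elusive D c [::]>].
have Pw : P [set w] by rewrite /P set11; apply/asboolP; exists a.
case: (@arg_maxnP _ [set w] P (fun D => #|D|) Pw) => D /andP[wD /asboolP[c0 elc0]] Dmax.
have Dabs x c : elusive (x |: D) c [::] -> x \in D.
  move=> el; have /Dmax : P (x |: D).
    by rewrite /P in_setU1 wD orbT; apply/asboolP; exists c.
  by rewrite /= cardsU1; case: (x \in D) => //; rewrite add1n /= ltnn.
(* Terminality of [c] allows the passage from [c] to [eval3 (d i) w w c] below to be undone. *)
have [c c0c cterm] : exists2 c, (forall s, elusive D c0 s -> elusive D c s) &
    forall c', (forall s, elusive D c s -> elusive D c' s) ->
               (forall s, elusive D c' s -> elusive D c s).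
  apply: (@finite_terminal _ (fun c c' => forall s, elusive D c s -> elusive D c' s)) => //.
  by move=> x y z xy yz s /xy /yz.
have [i [le_im elv nelv]] := elusive_crossing wB (c0c _ elc0).
exists D, (eval3 (d i) c c w); split=> //.
  by move=> j y Dy; apply: (Dabs _ c0); apply: elusive_op.
have step s : elusive D c s ->
    elusive D (eval3 (d i) w w c) (eval3 (d i) c c w :: s).
  by apply: elusive_step => //; apply: dB.
have back := cterm (eval3 (d i) w w c).
(* Each pass through [step] and [back] returns to [c] with one more copy of [eval3 (d i) c c w]
   listed. *)
apply: (Dabs _ c); apply: elusive_setU1 => n; elim: n => [|n IH]; first exact: c0c.
by apply: back (step _ IH) => s /step; apply/elusive_subseq/subseq_cons.
Qed.

Definition meets (D C : {set A}) (z : seq A) : Prop := all [in D] z /\ has [in C] z.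

Lemma meets_perm D C x y : perm_eq x y -> meets D C x -> meets D C y.
Proof. by move=> pxy []; split; [rewrite -(perm_all _ pxy) | rewrite -(perm_has _ pxy)]. Qed.

Lemma blocker_of_elusive (D : {set A}) w x : subuniverse (@op) D -> w \in B -> w \in D ->
  x \in D -> elusive D x [::] -> exists C, blocker (@op) B C D.
Proof.
move=> subD wB wD xD elx.
pose P (C : {set A}) := [&& C \subset D, x \in C & `[<Bfree (Sg (meets D C))>]].
have Px : P [set x].
  rewrite /P sub1set xD set11; apply/asboolP; apply: Bfree_sub elx; apply: Sg_sub.
  move=> z [Dz /hasP[x' zx' /set1P x'E]]; rewrite x'E in zx'; apply: Sg_gen.
  exists [::], (rem x z); split; rewrite ?perm_to_rem //.
  by apply/allP => t /mem_rem; apply: (allP Dz).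
case: (@arg_maxnP _ [set x] P (fun C => #|C|) Px) => C /and3P[sCD xC /asboolP freeC] Cmax.
set R := Sg (meets D C) in freeC.
have Rperm y z : perm_eq y z -> R y -> R z by apply/Sg_perm/meets_perm.
have Rcat y z : all [in D] y -> R z -> R (y ++ z).
  move=> Dy Rz; rewrite -[z]cats0.
  refine (Sg_min (@closed_fiber R y [::] (@Sg_closed _)) _ Rz) => {Rz}z [Dz Cz].
  by apply: Sg_gen; rewrite cats0; split; rewrite ?all_cat ?has_cat ?Dy ?Cz ?orbT.
(* The entries [ds] outside [C] are replaced one by one by tuples over [B], until [freeC] is
   contradicted. *)
have avoid ds b : all [in D :\: C] ds -> all [in D] b -> all [in B] b -> ~ R (ds ++ b).
  elim: ds b => [|e ds IH] b /=; first by move=> _ _; apply: freeC.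
  move=> /andP[+ Dds] Db Bb Reds; rewrite in_setD => /andP[eC eD].
  (* By maximality of [C], adjoining [e] destroys B-freeness; the resulting [z] takes the place of
     [e]. *)
  have [z Bz Sz] : exists2 z, all [in B] z & Sg (meets D (e |: C)) z.
    apply: not_Bfree => free; have /Cmax : P (e |: C).
      by rewrite /P subUset sub1set eD sCD in_setU1 xC orbT; apply/asboolP.
    by rewrite /= cardsU1 eC ltnn.
  have Dz : all [in D] z.
    by elim: Sz {Bz} => [y []//|i cols _ Dcols]; apply: all_op.
  apply: (IH (z ++ b)); rewrite ?all_cat ?Dz ?Bz //.
  apply: (Rperm (z ++ ds ++ b)); first by rewrite perm_catCA.
  refine (Sg_min (@closed_fiber R [::] (ds ++ b) (@Sg_closed _)) _ Sz) => y [Dy /hasP[t yt]].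
  have Dds' : all [in D] ds by apply: sub_all Dds => u /setDP[].
  rewrite in_setU1 => /orP[/eqP te | tC]; last first.
    apply: Sg_gen; split; first by rewrite !all_cat Dy Dds' Db.
    by rewrite /= has_cat; apply/orP; left; apply/hasP; exists t.
  rewrite te in yt; apply: (Rperm (rem e y ++ (e :: ds ++ b))).
    by rewrite (perm_catCA (rem e y) [:: e]) /= -cat_cons perm_cat2r perm_sym perm_to_rem.
  by apply: Rcat Reds; apply/allP => u /mem_rem; apply: (allP Dy).
exists C; split=> //.
- by split=> //; apply/set0Pn; exists x.
- apply/pred0P => c; apply/negbTE/negP => /= /andP[cC cB].
  apply: (freeC [:: c]); first by rewrite /= cB.
  by apply: Sg_gen; split; rewrite /= ?cC ?(subsetP sCD).
- by apply/pred0Pn; exists w; rewrite /= wD.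
move=> n n0 i y Hy; split=> [k|]; first by apply: subD => j; case: (Hy j).
move=> allDC.
apply: (avoid [seq op (fun j => y j k) | k <- enum 'I_n] [::]) => //.
  by rewrite all_map; apply/allP => k _ /=.
rewrite cats0.
have := @Sg_closed (meets D C) i [seq (fun j => y j k) | k <- enum 'I_n].
rewrite -map_comp; apply=> j; apply: Sg_gen; rewrite -map_comp.
case: (Hy j) => Dy nCy; split; first by rewrite all_map; apply/allP => k _ /=.
apply: contrapT => /negP; rewrite -all_predC all_map => /allP noC; apply: nCy => k.
by rewrite in_setD Dy andbT; apply: noC; rewrite mem_enum.
Qed.

(** * Eliminating the difference between left and right neighbours *)

Section Thresholds.

Variable be : A.
Hypothesis beB : be \in B.

Implicit Types (W : seq A -> Prop) (L : {set A}).

Definition threshold W (a : A) (z : seq A) : Prop :=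
  exists u v, [/\ W u, all (pred1 be) v & z = u ++ a :: v].

Definition valid W a : Prop := Bfree (Sg (threshold W a)).

(** Every letter is repeated [q + 1] times; the first [q] copies form the block that [closed_weave]
    can project away. *)
Definition stretch q (u : seq A) : seq A := weave [seq nseq q c | c <- u] u.

(* Stretching makes room for the blocks over B which are projected away in
   [reach_step]. *)
Definition stretchable W : Prop :=
  (forall u, W u -> all [in B] u) /\ (forall q u, W u -> W (stretch q u)).

Definition append W L (z : seq A) : Prop :=
  exists u v, [/\ W u, all [in L] v & z = u ++ v].

Definition stable W L : Prop := forall u v, W u -> all [in L] v -> W (u ++ v).

Definition star L (u : seq A) : Prop := all [in L] u.

Definition state (p : {set A} * A) : Prop := p.1 \subset B /\ p.1 != set0.

(* The words over [p'.1] are appended to those over [p.1], so that returning to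
   [p] again and again allows arbitrary words over the union, see [reach_setU]. *)
Definition reach (p p' : {set A} * A) : Prop := state p -> state p' /\
  forall W, stretchable W -> stable W p.1 -> valid W p.2 -> valid (append W p'.1) p'.2.

Lemma valid_sub W W' a : (forall u, W u -> W' u) -> valid W' a -> valid W a.
Proof.
move=> sub; apply: Bfree_sub; apply: Sg_sub => z [u [v [Wu bev ->]]]; apply: Sg_gen.
by exists u, v; split=> //; apply: sub.
Qed.

Lemma stretch_all (P : pred A) q u : all P u -> all P (stretch q u).
Proof.
move=> Pu; apply: all_weave => //; rewrite all_map.
by apply: sub_all Pu => c Pc; rewrite /= all_nseq Pc orbT.
Qed.

Lemma stretch_cat q u v : stretch q (u ++ v) = stretch q u ++ stretch q v.
Proof. by rewrite /stretch map_cat weave_cat ?size_map. Qed.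

Lemma map_stretch (f : A -> A) q u : map f (stretch q u) = stretch q (map f u).
Proof.
rewrite /stretch map_weave -!map_comp; congr weave.
by apply: eq_map => c /=; rewrite map_nseq.
Qed.

Lemma all_imset (f : A -> A) L u : all [in f @: L] u -> exists2 v, all [in L] v & u = map f v.
Proof.
elim: u => [|c u IH] /=; first by exists [::].
case/andP => /imsetP[y yL ->] /IH[v Lv ->].
by exists (y :: v); rewrite //= yL.
Qed.

Lemma stretchable_star L : L \subset B -> stretchable (star L).
Proof.
move=> sLB; split=> [u|q u]; last exact: stretch_all.
by apply: sub_all => c; apply: (subsetP sLB).
Qed.

Lemma stretchable_append W L : L \subset B -> stretchable W -> stretchable (append W L).
Proof.
move=> sLB [WB Wst]; split=> [z [u [v [Wu Lv ->]]]|q z [u [v [Wu Lv ->]]]].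
  by rewrite all_cat WB //; apply: sub_all Lv => c; apply: (subsetP sLB).
exists (stretch q u), (stretch q v); rewrite stretch_cat; split=> //; first exact: Wst.
exact: stretch_all.
Qed.

Lemma stable_append W L : stable (append W L) L.
Proof.
move=> z t [u [v [Wu Lv ->]]] Lt; exists u, (v ++ t).
by rewrite catA all_cat Lv Lt.
Qed.

Lemma reach_refl p : reach p p.
Proof.
move=> st; split=> // W _ Wstab; apply: (@valid_sub _ W) => z [u [v [Wu Lv ->]]].
exact: Wstab.
Qed.

Lemma reach_trans p q r : reach p q -> reach q r -> reach p r.
Proof.
move=> pq qr stp; have [stq {}pq] := pq stp; have [str {}qr] := qr stq.
split=> // W Wst Wstab Wval.
have := qr _ (stretchable_append stq.1 Wst) (@stable_append _ _) (pq W Wst Wstab Wval).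
apply: valid_sub => z [u [v [Wu Lv ->]]]; exists u, v; split=> //.
by exists u, [::]; rewrite cats0.
Qed.

Lemma reach_valid p q : state p -> reach p q -> valid (star p.1) p.2 -> valid (star q.1) q.2.
Proof.
move=> stp pq val; have [_ {}pq] := pq stp.
have stab : stable (star p.1) p.1 by move=> u v Lu Lv; rewrite /star all_cat Lu.
apply: valid_sub (pq _ (stretchable_star stp.1) stab val) => u Lu.
by exists [::], u.
Qed.

(** Each round trip from [p] to [q] and back appends a word over [q.1] and then one over [p.1]; one
    round suffices per letter of a word over the union. *)
Lemma reach_setU p q : reach p q -> reach q p -> reach p (p.1 :|: q.1, p.2).
Proof.
move=> pq qp stp; have [stq pq'] := pq stp; have [_ qp'] := qp stq.
split=> [|W Wst Wstab Wval].
  split; first by rewrite subUset stp.1 stq.1.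
  by apply: contra_neq stp.2 => /eqP; rewrite setU_eq0 => /andP[/eqP].
pose V n := iter n (fun V => append (append V q.1) p.1) W.
have V_ok n : [/\ stretchable (V n), stable (V n) p.1 & valid (V n) p.2].
  elim: n => [|n [Vst Vstab Vval]] //=; split.
  - exact: (stretchable_append stp.1 (stretchable_append stq.1 Vst)).
  - exact: stable_append.
  apply: qp'; first exact: (stretchable_append stq.1 Vst).
  - exact: stable_append.
  exact: pq'.
have V_in u v : W u -> all [in p.1 :|: q.1] v -> V (size v) (u ++ v).
  move=> Wu; elim/last_ind: v => [|v c IH]; first by rewrite cats0.
  rewrite all_rcons size_rcons => /andP[+ /IH Vuv] /=.
  rewrite in_setU => /orP[cp|cq].
    exists (u ++ v), [:: c]; rewrite /= cp cats1 rcons_cat; split=> //.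
    by exists (u ++ v), [::]; rewrite cats0.
  exists (u ++ rcons v c), [::]; rewrite cats0; split=> //.
  by exists (u ++ v), [:: c]; rewrite /= cq cats1 rcons_cat.
have V_mono n k z : V n z -> V (k + n) z.
  move=> Vz; elim: k => [|k IH] //; rewrite addSn /=.
  exists z, [::]; rewrite cats0; split=> //.
  by exists z, [::]; rewrite cats0.
(* The length of [x] bounds the length of the appended words, hence the number of rounds needed. *)
move=> x Bx /Sg_size Sx; have [_ _ val] := V_ok (size x); apply: (val x Bx).
apply: Sg_sub Sx => z [[_ [r [[u [v [Wu Lv ->]]] ber ->]]] szx]; apply: Sg_gen.
exists (u ++ v), r; split=> //.
have le : size v <= size x by rewrite -szx !size_cat -addnA addnCA leq_addr.
by rewrite -(subnK le); apply/V_mono/V_in.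
Qed.

Lemma reach_step L a i y : (forall w c, w \in B -> ~ elusive [set w] c [::]) ->
  i <= m -> y \in L -> eval3 (d i) be y y \in L ->
  reach (L, a) (eval3 (d i) be be @: L, eval3 (d i) be be a).
Proof.
move=> noloop le_im yL; set w := eval3 (d i) be y y => wL [/= sLB _].
set f := eval3 (d i) be be.
have fB c : c \in L -> f c \in B by move=> cL; apply: dB => //; apply: (subsetP sLB).
split; first split.
- by apply/subsetP => _ /imsetP[c cL ->]; apply: fB.
- by apply/set0Pn; exists (f y); apply: imset_f.
move=> W [WB Wst] Wstab; rewrite /= => Wval.
set R := Sg (threshold W a) in Wval.
have Rcl : closed R by apply: Sg_closed.
set e := eval3 (d i) be a y.
have eB : e \in B by apply: dB => //; apply: (subsetP sLB).
set v0 := eval3 (d i) a y y.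
(* The nonmember [v0] of the new tuples is moved into [B], using the tuples over [w] around it. *)
have [x Bx Sx] := not_Bfree (noloop w v0 (subsetP sLB w wL)).
have RI u v : W u -> all (pred1 be) v -> R (u ++ a :: v).
  by move=> Wu bev; apply: Sg_gen; exists u, v.
pose tripled (r : seq A) := [seq (c, c, c) | c <- r].
have evalt r : [seq eval3 (d i) p.1.1 p.1.2 p.2 | p <- tripled r] = r.
  by rewrite -map_comp -[RHS]map_id; apply: eq_map => c /=; rewrite eval3_idem.
have t11 r : [seq p.1.1 | p <- tripled r] = r by rewrite -map_comp map_id.
have t12 r : [seq p.1.2 | p <- tripled r] = r by rewrite -map_comp map_id.
have t2 r : [seq p.2 | p <- tripled r] = r by rewrite -map_comp map_id.
have R_junk u t v : W u -> all [in L] t -> all (pred1 be) v ->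
    R (u ++ x ++ e :: map f t ++ f a :: v).
  move=> Wu Lt bev.
  refine (Sg_min (@closed_fiber R u (e :: map f t ++ f a :: v) Rcl) _ Sx) => z
    /elusive_gen_set1[z1 [z2 [-> /all_pred1P-> /all_pred1P->]]].
  set j := size z1; set p := size z2.
  have Wu' : W (u ++ nseq j w) by apply: Wstab => //; rewrite all_nseq wL orbT.
  (* The rows have [a] at three successive places, with only [be] to its right and a word of [W] to
     its left. The [p] triples [(be, y, y)] produce the letters [w] to the right of [v0]. *)
  have := @closed_eval3 R (d i) (tripled u ++ tripled (nseq j w) ++ (a, y, y) ::
    nseq p (be, y, y) ++ (be, a, y) :: [seq (be, be, c) | c <- t] ++ (be, be, a) ::
    tripled v) Rcl.
  rewrite !(map_cat, map_cons, map_nseq, t11, t12, t2, evalt) /=.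
  rewrite -!map_comp -/f -/w -/v0 -/e -!catA /=; apply.
  - rewrite catA; apply: RI => //.
    rewrite all_cat all_nseq /= !eqxx orbT /= all_cat /= eqxx bev !andbT.
    by rewrite all_map; apply/allP => c _ /=.
  - rewrite -cat_cons !catA; apply: RI; last first.
      by rewrite all_cat /= eqxx bev ?andbT all_map; apply/allP => c _ /=.
    by apply: Wstab => //; rewrite /= yL all_nseq yL orbT.
  rewrite map_id -!cat_cons !catA; apply: RI => //.
  rewrite -!catA catA; apply: Wstab => //.
  by rewrite /= yL all_cat all_nseq yL orbT /= yL.
(* The place of [X] varies with the generator. To project away the same coordinates throughout, a
   block of this length is put in front of every letter. *)
pose X := rcons x e.
have [q szX] : exists q, size X == q by exists (size X).
have R'cl := @closed_weave R q Rcl.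
have nseqB c : c \in B -> all [in B] (nseq q c) by move=> cB; rewrite all_nseq cB orbT.
have BL u : all [in L] u -> all [in B] [seq f c | c <- u].
  by rewrite all_map; apply: sub_all => c /fB.
have B_be v : all (pred1 be) v -> all [in B] v by apply: sub_all => c /eqP->.
have sznseq u : all (fun s : seq A => size s == q) [seq nseq q c | c <- u].
  by rewrite all_map; apply/allP => c _ /=; rewrite size_nseq.
have Bnseq u : all [in B] u -> all (all [in B]) [seq nseq q c | c <- u].
  by rewrite all_map; apply: sub_all => c cB /=; apply: nseqB.
have BX : all [in B] X by rewrite all_rcons eB.
move=> z Bz Sz; have [|g [_ _ Bg Rg]] := Sg_min R'cl _ Sz; last first.
  by apply: (Wval (weave g z)); rewrite ?all_weave.
move=> z' [u' [v [[u [t' [Wu /all_imset[t Lt ->] ->]]] bev ->]]].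
case: t Lt => [|c t] /=.
  exists (map (nseq q) u ++ X :: map (nseq q) v); split.
  - by rewrite cats0 !size_cat /= !size_map.
  - by rewrite all_cat /= szX !sznseq.
  - by rewrite all_cat /= BX (Bnseq _ (WB _ Wu)) (Bnseq _ (B_be _ bev)).
  rewrite cats0 weave_cat ?size_map //.
  have -> : weave (X :: map (nseq q) v) (f a :: v) = x ++ e :: f a :: stretch q v.
    by rewrite /weave /= !cat_rcons.
  by apply: (R_junk _ [::]); [apply: Wst | | apply: stretch_all].
move=> /andP[cL Lt].
(* [X] goes before the first letter after [u]. The block before [f a] consists of copies of [f y],
   since [f a] must occur only once. *)
exists (map (nseq q) u ++ X :: map (nseq q) (map f t) ++ nseq q (f y) :: map (nseq q) v); split.
- by rewrite -catA !size_cat /= !size_cat /= !size_map.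
- by rewrite all_cat /= szX all_cat /= size_nseq eqxx !sznseq.
- by rewrite all_cat /= BX all_cat /= nseqB ?fB // (Bnseq _ (WB _ Wu))
    (Bnseq _ (BL _ Lt)) (Bnseq _ (B_be _ bev)).
rewrite -catA weave_cat ?size_map //.
have -> : weave (X :: map (nseq q) (map f t) ++ nseq q (f y) :: map (nseq q) v)
                (f c :: map f t ++ f a :: v) =
          x ++ e :: map f (c :: stretch q t ++ nseq q y) ++ f a :: stretch q v.
  rewrite /= map_cat map_stretch map_nseq -catA.
  rewrite -[LHS]/(rcons X (f c) ++ weave (map (nseq q) (map f t) ++ nseq q (f y) :: map (nseq q) v)
    (map f t ++ f a :: v)) weave_cat ?size_map //.
  rewrite -[weave (_ :: _) (_ :: _)]/(rcons (nseq q (f y)) (f a) ++ stretch q v).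
  by rewrite !cat_rcons.
apply: R_junk; [exact: Wst | | exact: stretch_all].
by rewrite /= cL all_cat stretch_all // all_nseq yL orbT.
Qed.

Lemma valid_elusive b' a : b' \in B -> valid (star [set b']) a ->
  exists w c, w \in B /\ elusive [set w] c [::].
Proof.
move=> b'B val; apply: contrapT => nex.
have noloop w c : w \in B -> ~ elusive [set w] c [::] by move=> wB el; apply: nex; exists w, c.
have st0 : state ([set b'], a).
  by split; rewrite /= ?sub1set //; apply/set0Pn; exists b'; rewrite set11.
have [p p0p pterm] := finite_terminal ([set b'], a) reach_refl reach_trans.
(* Every state reachable from the terminal [p] leads back to [p]; so by [reach_setU] a largest [L]
   contains the letters of all states reachable from it. *)
case: (@arg_maxnP _ p (fun q => `[<reach p q>]) (fun q => #|q.1|)).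
  exact/asboolP/reach_refl.
move=> [L c] /asboolP pLc max.
have Lmax q : reach (L, c) q -> q.1 \subset L.
  move=> rq; have rpq := reach_trans pLc rq.
  have rLq := reach_setU rq (reach_trans (pterm _ rpq) pLc).
  have /max : `[<reach p (L :|: q.1, c)>] by apply/asboolP/(reach_trans pLc).
  move=> le; rewrite (_ : L = L :|: q.1) ?subsetUr //.
  by apply/eqP; rewrite eqEcard subsetUl.
have r0 := reach_trans p0p pLc; have [[sLB /= /set0Pn[y yL]] _] := r0 st0.
(* Descent from [d m] to [d 0]: by [d_link], closure under one map gives the hypothesis of
   [reach_step] for the preceding one. *)
have stay k y' : k <= m -> y' \in L -> eval3 (d (m - k)) be be y' \in L.
  elim: k y' => [|k IH] y' le_km y'L; first by rewrite subn0 d_last.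
  have lt : m - k.+1 < m by rewrite ltn_subLR // ltnS leq_addl.
  have step : reach (L, c) (eval3 (d (m - k.+1)) be be @: L, eval3 (d (m - k.+1)) be be c).
    apply: (@reach_step L c _ y' noloop) => //; first exact: leq_subr.
    by rewrite d_link // subnSK // IH // ltnW.
  by apply: (subsetP (Lmax _ step)); apply: imset_f.
have beL : be \in L by have := stay m y (leqnn m) yL; rewrite subnn d_first.
apply: (noloop be c beB); apply: Bfree_sub (reach_valid st0 r0 val); apply: Sg_sub.
move=> z /elusive_gen_set1[z1 [z2 [-> be1 be2]]]; apply: Sg_gen; exists z1, z2; split=> //.
by apply: sub_all be1 => k /eqP->.
Qed.

End Thresholds.

(** * Relations witnessing the failure of absorption *)

(** Induction on a set [Y] of tuples with at most one entry outside [B] gives a term sending all of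
    [Y] into [B]; finally [Y] consists of all such tuples. *)
Lemma absorbs_of_relations N :
  (forall (R : ('I_N -> A) -> Prop) (r : 'I_N -> 'I_N -> A),
     subuniverse_pow (@op) R -> (forall k, R (r k)) ->
     (forall k j, j != k -> r k j \in B) ->
     exists2 x, R x & forall k, x k \in B) ->
  absorbs (@op) B.
Proof.
move=> Rmeets.
pose near (y : {ffun 'I_N -> A}) := #|[set k | y k \notin B]| <= 1.
suff good n (Y : seq {ffun 'I_N -> A}) : size Y < n -> all near Y ->
    exists t : term ar N, forall y, y \in Y -> eval (@op) t y \in B.
  have [t tB] := good _ (filter near (enum {: {ffun 'I_N -> A}})) (leqnn _) (filter_all _ _).
  exists N, t; split=> [a|x nx]; first exact: eval_idem.
  have xE : x = finfun x by apply: funext => k; rewrite ffunE.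
  rewrite xE; apply: tB; rewrite mem_filter mem_enum andbT /near.
  by under eq_finset do rewrite ffunE.
elim: n Y => // n IH Y; rewrite ltnS => leYn nearY.
have [[k kB]|noproj] := EM (exists k, forall y, y \in Y -> y k \in B).
  by exists (Var ar k).
have bad k : exists y, y \in Y /\ y k \notin B.
  apply: contrapT => /forallNP nbad; apply: noproj; exists k => y yY.
  by apply: contrapT => /negP nB; apply: (nbad y).
have [y Hy] := fin_all_exists bad.
(* A tuple of [Y] has at most one bad coordinate. *)
have y_inj k j : y k = y j -> k = j.
  move=> ykj; have [_ ykB] := Hy k; have [yY yjB] := Hy j.
  have /(allP nearY) : y j \in Y by [].
  move=> /card_le1_eqP; apply; rewrite inE //.
  by rewrite -ykj.
have tk k : exists t : term ar N, forall z, z \in filter (predC1 (y k)) Y -> eval (@op) t z \in B.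
  apply: IH; last by apply/allP => z; rewrite mem_filter => /andP[_ /(allP nearY)].
  apply: leq_trans leYn; rewrite size_filter -(count_predC (predC1 (y k)) Y) -addn1 leq_add2l.
  by rewrite -has_count; apply/hasP; exists (y k); rewrite ?(Hy k).1 //= eqxx.
have [t Ht] := fin_all_exists tk.
(* The values at the [y k] of the terms that already send the rest of [Y] into [B]; a tuple of [R]
   over [B] is a term good on all of [Y]. *)
pose R (x : 'I_N -> A) := exists t0 : term ar N,
  (forall z, z \in Y -> (forall k, z != y k) -> eval (@op) t0 z \in B) /\
  (forall k, x k = eval (@op) t0 (y k)).
have Rpow : subuniverse_pow (@op) R.
  move=> i x /fin_all_exists[ts Hts]; exists (App ts); split=> [z zY nz|k] /=.
    by apply: subB => j; apply: (Hts j).1.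
  by congr op; apply: funext => j; apply: (Hts j).2.
have [||x [t0 [t0B xE]] xB] := Rmeets R (fun k j => eval (@op) (t k) (y j)) Rpow.
- move=> k; exists (t k); split=> // z zY nz; apply: Ht.
  by rewrite mem_filter /= nz.
- move=> k j njk; apply: Ht; rewrite mem_filter /= (Hy j).1 andbT.
  by apply: contra_neq njk; apply: y_inj.
exists t0 => z zY; have [[k ->]|nz] := EM (exists k, z = y k); first by rewrite -xE.
by apply: t0B => // k; apply/eqP => zE; apply: nz; exists k.
Qed.

Lemma not_absorbs_valid : ~ absorbs (@op) B ->
  exists be b' a, [/\ be \in B, b' \in B & valid be (star [set b']) a].
Proof.
move=> nabs; apply: contrapT => nex.
have term3 (p : A * A * A) : exists x : seq A, p.1.2 \in B -> p.2 \in B ->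
    all [in B] x /\ Sg (threshold p.1.2 (star [set p.2]) p.1.1) x.
  have [[eB fB]|nB] := EM (p.1.2 \in B /\ p.2 \in B); last first.
    by exists [::] => eB fB; case: nB.
  have [|x Bx Sx] := @not_Bfree (Sg (threshold p.1.2 (star [set p.2]) p.1.1)).
    by move=> val; apply: nex; exists p.1.2, p.2, p.1.1.
  by exists x.
have {term3}[x Hx] := fin_all_exists term3.
pose n := \max_p size (x p).
(* Two extra positions: [be] and [b'] can be read off even for [n = 0], and each position used has a
   later one. *)
have [N HN] := pairwise_ramsey (b0, b0, b0) n.+2.
apply: nabs; apply: (@absorbs_of_relations N) => R r Rpow Rr rB.
pose c (i j : 'I_N) := (r i i, r i j, r j i).
have [|t [[[a be] b'] [sub_t szt /(pairwiseP _) hom]]] := HN _ (enum 'I_N) c (enum_uniq _).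
  by rewrite size_enum_ord.
have ut : uniq t := subseq_uniq sub_t (enum_uniq _).
case: t szt sub_t ut hom => // i0 t' szt _ ut hom; set t := i0 :: t' in szt ut hom.
have homE p l : p < l -> l < n.+2 ->
    [/\ r (nth i0 t p) (nth i0 t p) = a, r (nth i0 t p) (nth i0 t l) = be
      & r (nth i0 t l) (nth i0 t p) = b'].
  move=> ltpl ltl; have /eqP[] // : c (nth i0 t p) (nth i0 t l) == (a, be, b').
  by apply: hom => //; rewrite inE szt // (ltn_trans ltpl).
have n01 : nth i0 t 0 != nth i0 t 1 by rewrite nth_uniq ?szt.
have [_ be01 b'01] := homE 0 1 isT isT.
have beB : be \in B by rewrite -be01; apply: rB; rewrite eq_sym.
have b'B : b' \in B by rewrite -b'01; apply: rB.
have [Bx Sx] := Hx (a, be, b') beB b'B; rewrite /= in Sx.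
set z := x (a, be, b') in Bx Sx.
have szz : size z <= n by apply: (@leq_bigmax _ (fun p => size (x p))).
pose t0 := take (size z) t.
have szt0 : size t0 = size z by rewrite size_takel // szt; apply: leqW; apply: leqW.
(* Only the length of [z] matters; at other lengths [R'] holds vacuously. *)
pose R' (s : seq A) := size s = size z ->
  exists y, [/\ R y, [seq y k | k <- t0] = s & forall j, j \notin t0 -> y j \in B].
have R'cl : closed R'.
  move=> i cols Rcols; rewrite /R' size_map => szc.
  have /fin_all_exists[y Hy] j := Rcols j (etrans (size_map _ _) szc).
  exists (fun k => op (fun j => y j k)); split.
  - by apply: Rpow => j; case: (Hy j).
  - pose c0 : 'I_(ar i) -> A := fun=> b0.
    apply: (@eq_from_nth _ b0) => [|k]; first by rewrite !size_map szt0.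
    rewrite size_map => ltk; rewrite (nth_map i0) // (nth_map c0) ?szc -?szt0 //.
    congr op; apply: funext => j; case: (Hy j) => _ yE _.
    by rewrite -(nth_map i0 b0) // yE (nth_map c0) ?szc -?szt0.
  by move=> k kt0; apply: subB => j; case: (Hy j) => _ _; apply.
have [|//|y [Ry yE yB]] := Sg_min R'cl _ Sx.
  move=> _ [u [v [/= ub' vbe ->]]]; rewrite /R' size_cat /= => szuv.
  have ltu : size u < size z by rewrite -szuv addnS ltnS leq_addr.
  have lt2 k : k < size z -> k.+1 < n.+2.
    by move=> ltk; rewrite !ltnS; apply: leq_trans (ltnW ltk) szz.
  have nt0 k : k < size z -> nth i0 t0 k = nth i0 t k by move=> ltk; rewrite nth_take.
  exists (r (nth i0 t (size u))); split=> //.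
    apply: (@eq_from_nth _ b0) => [|k]; first by rewrite size_map szt0 size_cat.
    rewrite size_map szt0 => ltk; rewrite (nth_map i0) ?szt0 // nt0 // nth_cat.
    case: ltngtP => [ltku|gtku|->].
    - have [|_ _ ->] := homE _ _ ltku; first exact: ltnW (lt2 _ ltu).
      by have /allP/(_ _ (mem_nth b0 ltku))/set1P := ub'.
    - have [|_ -> _] := homE _ _ gtku; first exact: ltnW (lt2 _ ltk).
      have -> : k - size u = (k - (size u).+1).+1 by rewrite subnSK.
      rewrite /=; apply/esym/eqP; apply: (allP vbe); apply: mem_nth.
      by rewrite ltn_subLR // addSn -addnS szuv.
    by rewrite subnn /=; case: (homE _ _ (ltnSn (size u)) (lt2 _ ltu)).
  move=> j jt0; apply: rB; apply: contraNneq jt0 => ->.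
  by rewrite -nt0 // mem_nth // szt0.
exists y => // k; have [kt0|] := boolP (k \in t0); last exact: yB.
by apply: (allP Bx); rewrite -yE; apply: map_f.
Qed.

Lemma absorbs_of_no_blocker :
  ~ (exists C D, blocker (@op) B C D) -> absorbs (@op) B.
Proof.
move=> noblk; apply: contrapT => /not_absorbs_valid[be [b' [a [beB b'B val]]]].
have [w [c [wB elc]]] := valid_elusive beB b'B val.
have [D [x [subD wD xD elx]]] := elusive_self wB elc.
have [C blk] := blocker_of_elusive subD wB wD xD elx.
by apply: noblk; exists C, D.
Qed.

End Relations.
(** * Consequences of absorption *)

Fixpoint subst (I : Type) (ar : I -> nat) (n k : nat) (t : term ar n)
    (s : 'I_n -> term ar k) : term ar k :=
  match t with
  | Var j => s j
  | App i ts => App (fun j => subst (ts j) s)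
  end.

Lemma eval_subst (A I : Type) (ar : I -> nat) (op : forall i, ('I_(ar i) -> A) -> A)
    (n k : nat) (t : term ar n) (s : 'I_n -> term ar k) (x : 'I_k -> A) :
  eval op (subst t s) x = eval op t (fun j => eval op (s j) x).
Proof. by elim: t => //= i ts IH; congr op; apply: funext. Qed.

Section Absorption.

Variables (A : finType) (I : Type) (ar : I -> nat).
Variable op : forall i, ('I_(ar i) -> A) -> A.
Variable B : {set A}.

(** The term [d i.+1] is [t] with [z] before position [i], [y] at it and [x] after it. Setting [y]
    to [z] there, or to [x] in the next term, gives the same arguments. *)
Lemma absorbs_jonsson_absorbs : absorbs op B -> jonsson_absorbs op B.
Proof.
move=> [n [t [t_idem tB]]].
pose o0 : 'I_3 := Ordinal (isT : 0 < 3).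
pose o1 : 'I_3 := Ordinal (isT : 1 < 3).
pose o2 : 'I_3 := Ordinal (isT : 2 < 3).
pose shift i : term ar 3 :=
  subst t (fun k => Var ar (if k < i then o2 else if k == i :> nat then o1 else o0)).
pose d i : term ar 3 :=
  if i is i'.+1 then if i' < n then shift i' else Var ar o2 else Var ar o0.
have shiftE i x y z : eval op (shift i) (tri x y z) =
    eval op t (fun k => if k < i then z else if k == i :> nat then y else x).
  rewrite eval_subst; congr eval; apply: funext => k /=.
  by case: ltngtP.
exists n.+1, d; split; last split; last split=> //=; last by rewrite ltnn.
  move=> [|i] _ b a b' bB b'B //=; case: ifP => // lt_in.
  rewrite shiftE; apply: tB; rewrite -(cards1 (Ordinal lt_in)); apply: subset_leq_card.
  apply/subsetP => k; rewrite !inE -val_eqE /=.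
  by case: ltngtP; rewrite ?b'B ?bB.
have shift_first x y : eval op (d 1) (tri x x y) = x.
  rewrite /=; case: ifP => [_|n0].
    by rewrite shiftE -[RHS](t_idem x); congr eval; apply: funext => k; case: ltngtP.
  (* For [n = 0] the idempotent term is a constant, so all elements coincide. *)
  rewrite /= -[RHS](t_idem x) -[LHS](t_idem y); congr eval; apply: funext => k.
  by case: k n0 => k /=; case: (n).
move=> [|i] lt_in x y; first by rewrite shift_first.
rewrite ltnS in lt_in; rewrite [d i.+1]/= lt_in shiftE /=; case: ifP => [_|ge_in].
  by rewrite shiftE; congr eval; apply: funext => k; rewrite ltnS if_same; case: ltngtP.
rewrite /= -[RHS](t_idem y); congr eval; apply: funext => k.
have : k <= i by rewrite -ltnS; apply: leq_trans (ltn_ord k) _; rewrite leqNgt ge_in.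
by case: ltngtP.
Qed.

(** Apply [t] to the tuples with [c] on the diagonal and [b] elsewhere: each meets [C], but the
    result lies over [B] and so avoids [C]. *)
Lemma absorbs_no_blocker C D : absorbs op B -> ~ blocker op B C D.
Proof.
move=> [n [t [t_idem tB]]] [subD [/set0Pn[c cC] sCD] disCB /pred0Pn[b /= /andP[bD bB]] cross].
have cB : c \notin B by rewrite (disjointFr disCB cC).
have bC : b \notin C by rewrite (disjointFl disCB bB).
have n0 : 0 < n.
  case: n t t_idem {tB} => // t t_idem.
  have bc : b = c.
    by rewrite -[LHS]t_idem -[RHS]t_idem; congr eval; apply: funext => -[].
  by rewrite bc (negbTE cB) in bB.
pose S (x : 'I_n -> A) := (forall k, x k \in D) /\ ~ (forall k, x k \in D :\: C).
pose x j (k : 'I_n) := if k == j then c else b.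
have Sx j : S (x j).
  split=> [k|/(_ j)]; last by rewrite /x eqxx in_setD cC.
  by rewrite /x; case: ifP => // _; apply: (subsetP sCD).
have S_eval (u : term ar n) : S (fun k => eval op u (fun j => x j k)).
  by elim: u => [j|i ts IH] /=; [apply: Sx | apply: (cross n n0)].
have [Dt] := S_eval t; apply=> k; rewrite in_setD Dt andbT.
have /(disjointFl disCB) -> // : eval op t (fun j => x j k) \in B.
apply: tB; rewrite -(cards1 k); apply: subset_leq_card.
apply/subsetP => j; rewrite !inE /x eq_sym; case: eqP => //.
by rewrite bB.
Qed.

End Absorption.

Theorem theorem1p2 (A : finType) (I : Type) (ar : I -> nat)
  (op : forall i, ('I_(ar i) -> A) -> A) (B : {set A}) :
  idempotent_alg op -> subuniverse op B -> B != set0 ->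
  (absorbs op B <->
   (jonsson_absorbs op B /\ ~ (exists C D : {set A}, blocker op B C D))).
Proof.
move=> op_idem subB /set0Pn[b0 b0B]; split=> [absB|].
  split; first exact: absorbs_jonsson_absorbs.
  by move=> [C [D]]; apply: absorbs_no_blocker.
move=> [[m [d [dB [d_link [d_first d_last]]]]] noblk].
exact: (absorbs_of_no_blocker op_idem subB b0B dB d_link d_first d_last noblk).
Qed.
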